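(* Let $C_1,\ldots,C_N\subset\mathbb{R}^d$ be nonempty closed convex sets, let $\beta=(\beta_1,\ldots,\beta_N)\in\mathcal{B}$, and let $\kappa_1,\ldots,\kappa_N$ be any nonnegative numbers such that $\sum_{j=1}^N\kappa_j=1$. Then for any $x\in\mathbb{R}^d$ and any $c\in C_1\cap C_2\cap\cdots\cap C_N$, $$\|Q_\beta(x)-c\|^2\le\|x-c\|^2-\sum_{j=1}^N\left(2-\frac{\beta_j}{\kappa_j}\right)\beta_j\,\|x-P_{C_j}(x)\|^2 .$$
   Context: $\|\cdot\|$ is the Euclidean norm on $\mathbb{R}^d$, and for a nonempty closed convex set $D\subset\mathbb{R}^d$, $P_D$ denotes the (nearest point) projection onto $D$. The parameter set is $\mathcal{B}=\{\beta=(\beta_1,\ldots,\beta_N): \beta_i\ge 0 \text{ for all } i,\ \sum_{i=1}^N\beta_i\le 2\}$. For $\beta\in\mathcal{B}$ the operator $Q_\beta:\mathbb{R}^d\to\mathbb{R}^d$ is $Q_\beta=I-\sum_{j=1}^N\beta_j(I-P_{C_j})$, where $I$ is the identity. Conventions: $\beta_j/\kappa_j=0$ whenever $\beta_j=0$; and $\beta_j/\kappa_j=+\infty$ if $\beta_j>0$ and $\kappa_j=0$. The right-hand side is an extended real number, with the usual convention $(\pm\infty)\cdot 0=0$. *)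

(* Defs.v *)
From mathcomp Require Export all_boot all_order all_algebra.
From mathcomp Require Export all_classical all_reals all_analysis.
Export Order.TTheory GRing.Theory Num.Theory.
Export numFieldNormedType.Exports.

Set Implicit Arguments.
Unset Strict Implicit.
Unset Printing Implicit Defensive.

Local Open Scope classical_set_scope.
Local Open Scope ring_scope.

(* The library norm [`|x|] on ['rV[R]_d] is the sup norm, so the Euclidean
   norm is defined separately; both induce the same topology, so [closed]
   has its usual meaning. *)
Definition enorm (R : realType) (d : nat) (x : 'rV[R]_d) : R :=
  Num.sqrt (\sum_(i < d) x 0 i ^+ 2).

Definition nearest_points (R : realType) (d : nat) (D : set 'rV[R]_d)
    (x : 'rV[R]_d) : set 'rV[R]_d :=
  [set p | D p /\ forall q, D q -> enorm (x - p) <= enorm (x - q)].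

(* [nearest_points D x] is a singleton when [D] is nonempty, closed and convex;
   the default value 0 is used only when there is no nearest point. *)
Definition proj (R : realType) (d : nat) (D : set 'rV[R]_d) (x : 'rV[R]_d) :
    'rV[R]_d :=
  xget 0 (nearest_points D x).

Definition weights (R : realType) (N : nat) : set ('I_N -> R) :=
  [set beta | (forall i, 0 <= beta i) /\ \sum_(i < N) beta i <= 2].

Definition Qop (R : realType) (d N : nat) (C : 'I_N -> set 'rV[R]_d)
    (beta : 'I_N -> R) (x : 'rV[R]_d) : 'rV[R]_d :=
  x - \sum_(j < N) beta j *: (x - proj (C j) x).

(* Division in [\bar R] satisfies [0^-1 = +oo] and [0 * +oo = 0], so [b / k]
   obeys the conventions [0 / k = 0] (also for [k = 0]) and [b / 0 = +oo]
   for [b > 0]. *)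
Lemma ediv0 (R : realType) (k : R) : (0%:E / k%:E = 0 :> \bar R)%E.
Proof. exact: mul0e. Qed.

Lemma edive0 (R : realType) (b : R) : 0 < b -> (b%:E / 0%:E = +oo :> \bar R)%E.
Proof. by move=> b0; rewrite inve0 gt0_muley// lte_fin. Qed.

Lemma ediv_fin (R : realType) (b k : R) :
  k != 0 -> (b%:E / k%:E = (b / k)%:E :> \bar R)%E.
Proof. by move=> k0; rewrite inver (negPf k0). Qed.

(* Main.v *)
(** Put [u j = x - P_j x].  The variational inequality for the projection onto
    [C j] gives [<x - c, u j> >= |u j|^2], so expanding the square,
    [|Q x - c|^2 <= |x - c|^2 - 2 \sum_j beta j |u j|^2 + |\sum_j beta j u j|^2],
    and by Cauchy-Schwarz with weights [kappa j] the last term is at most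
    [\sum_j (beta j)^2 / kappa j |u j|^2].  A vanishing [kappa j] with
    [beta j u j != 0] makes the right-hand side of the claim [+oo]. *)

Require Import Defs.
From mathcomp Require Import ring lra.

Set Implicit Arguments.
Unset Strict Implicit.
Unset Printing Implicit Defensive.

Local Open Scope classical_set_scope.
Local Open Scope ring_scope.

Definition dot (R : realType) (d : nat) (u v : 'rV[R]_d) : R :=
  \sum_(i < d) u 0 i * v 0 i.

Lemma sqr_enorm (R : realType) (d : nat) (u : 'rV[R]_d) :
  enorm u ^+ 2 = \sum_(i < d) u 0 i ^+ 2.
Proof. by rewrite /enorm sqr_sqrtr// sumr_ge0// => i _; rewrite sqr_ge0. Qed.

Lemma enorm_ge0 (R : realType) (d : nat) (u : 'rV[R]_d) : 0 <= enorm u.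
Proof. exact: sqrtr_ge0. Qed.

Lemma sqr_enormB (R : realType) (d : nat) (u v : 'rV[R]_d) :
  enorm (u - v) ^+ 2 = enorm u ^+ 2 - 2 * dot u v + enorm v ^+ 2.
Proof.
rewrite !sqr_enorm /dot mulr_sumr -sumrB -big_split/=.
by apply: eq_bigr => i _; rewrite !mxE; ring.
Qed.

Lemma sqr_enormZ (R : realType) (d : nat) (t : R) (u : 'rV[R]_d) :
  enorm (t *: u) ^+ 2 = t ^+ 2 * enorm u ^+ 2.
Proof.
by rewrite !sqr_enorm mulr_sumr; apply: eq_bigr => i _; rewrite mxE exprMn.
Qed.

Lemma dotZr (R : realType) (d : nat) (t : R) (u v : 'rV[R]_d) :
  dot u (t *: v) = t * dot u v.
Proof.
by rewrite /dot mulr_sumr; apply: eq_bigr => i _; rewrite mxE mulrCA.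
Qed.

Lemma dot_sumr (R : realType) (d N : nat) (u : 'rV[R]_d)
    (v : 'I_N -> 'rV[R]_d) :
  dot u (\sum_(j < N) v j) = \sum_(j < N) dot u (v j).
Proof.
rewrite /dot exchange_big/=; apply: eq_bigr => i _.
by rewrite summxE mulr_sumr.
Qed.

Lemma dotBl (R : realType) (d : nat) (u v w : 'rV[R]_d) :
  dot (u - v) w = dot u w - dot v w.
Proof. by rewrite -sumrB; apply: eq_bigr => i _; rewrite !mxE mulrBl. Qed.

Lemma dot_self (R : realType) (d : nat) (u : 'rV[R]_d) : dot u u = enorm u ^+ 2.
Proof. by rewrite sqr_enorm; apply: eq_bigr => i _; rewrite expr2. Qed.

Lemma dotC (R : realType) (d : nat) (u v : 'rV[R]_d) : dot u v = dot v u.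
Proof. by apply: eq_bigr => i _; rewrite mulrC. Qed.

Lemma ler_coord_enorm (R : realType) (d : nat) (u : 'rV[R]_d) (i : 'I_d) :
  `|u 0 i| <= enorm u.
Proof.
rewrite -sqrtr_sqr; apply: ler_wsqrtr; rewrite (bigD1 i)//= lerDl.
by apply: sumr_ge0 => k _; exact: sqr_ge0.
Qed.

Lemma continuous_enormB (R : realType) (d : nat) (x : 'rV[R]_d) :
  continuous (fun y : 'rV[R]_d => enorm (x - y)).
Proof.
move=> y; rewrite /enorm.
apply: (@continuous_comp _ _ _
  (fun z : 'rV[R]_d => \sum_(i < d) (x - z) 0 i ^+ 2) Num.sqrt); last first.
  exact: sqrt_continuous.
apply: continuous_big => [|i _ {}y]; first exact: add_continuous.
under eq_fun do rewrite !mxE.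
apply: (@continuous_comp _ _ _
  (fun z : 'rV[R]_d => x 0 i - z 0 i) (fun r : R => r ^+ 2)); last first.
  exact: exprn_continuous.
by apply: continuousB; [exact: cst_continuous | exact: coord_continuous].
Qed.

(** The continuous distance to [x] attains its minimum on the part of [D] inside a compact box
    around [x]. *)
Lemma nearest_points_nonempty (R : realType) (d : nat) (D : set 'rV[R]_d)
    (x : 'rV[R]_d) :
  D !=set0 -> closed D -> nearest_points D x !=set0.
Proof.
move=> [q0 Dq0] Dclosed; pose M := enorm (x - q0).
(* The sup-norm ball of radius [M]; it contains the Euclidean ball of that radius. *)
pose box : set 'rV[R]_d :=
  [set v | forall i, v ord0 i \in `[x 0 i - M, x 0 i + M]].
have boxE q : enorm (x - q) <= M -> box q.
  move=> qM i; have := le_trans (ler_coord_enorm (x - q) i) qM.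
  by rewrite !mxE ler_norml in_itv/= => /andP[? ?]; apply/andP; split; lra.
have Kcompact : compact (D `&` box).
  rewrite setIC; apply: compact_closedI => //.
  exact: (@rV_compact R d (fun i => `[x 0 i - M, x 0 i + M]%classic)
    (fun i => @segment_compact R _ _)).
have Kq0 : (D `&` box) q0 by split=> //; exact: boxE.
have [p + pmin] := EVT_min_rV (ex_intro _ q0 Kq0) Kcompact
  (continuous_subspaceT (@continuous_enormB _ _ x)).
rewrite inE => -[Dp _]; exists p; split=> // q Dq.
(* A point of [D] farther than [M] cannot beat [q0], which is itself in the compact set. *)
have [qM|/ltW Mq] := leP (enorm (x - q)) M.
  by apply: pmin; rewrite inE; split=> //; exact: boxE.
by apply: le_trans Mq; apply: pmin; rewrite inE.
Qed.

(** Moving from [p] a fraction [t] of the way to [c] stays in [D], so minimality gives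
    [2 * t * s <= t ^+ 2 * n]; a small [t] refutes [s > 0]. *)
Lemma nearest_points_dot_le0 (R : realType) (d : nat) (D : set 'rV[R]_d)
    (x p c : 'rV[R]_d) :
  convex_set D -> nearest_points D x p -> D c -> dot (x - p) (c - p) <= 0.
Proof.
move=> Dconvex [Dp pmin] Dc.
set s := dot _ _; pose n := enorm (c - p) ^+ 2.
have n_ge0 : 0 <= n by rewrite sqr_ge0.
have moved t : 0 <= t -> t <= 1 -> 2 * t * s <= t ^+ 2 * n.
  move=> t0 t1.
  have t01 : Itv.spec (@Itv.num_sem R) (Itv.Real `[0%Z, 1%Z]) t.
    by rewrite /Itv.num_sem/= in_itv/= t0 t1 ger0_real.
  have := Dconvex c p (Itv.mk t01); rewrite !inE => /(_ Dc Dp) /pmin.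
  rewrite -(@ler_pXn2r _ 2%N isT (enorm _) (enorm _))// ?nnegrE ?enorm_ge0//.
  have -> : x - conv (Itv.mk t01) (c : convex_lmodType _) p
      = (x - p) - t *: (c - p).
    transitivity (x - (t *: c + (1 - t) *: p)); first by [].
    by apply/rowP => i; rewrite !mxE; ring.
  rewrite (sqr_enormB (x - p)) dotZr sqr_enormZ -/n -/s; lra.
rewrite leNgt; apply/negP => s_gt0.
have sn_gt0 : 0 < s + n by lra.
(* This [t] lies in []0, 1]], even when [n = 0], and [t * n = s - t * s < 2 * s], against
   [moved]. *)
pose t := s / (s + n).
have t_gt0 : 0 < t by rewrite divr_gt0.
have t_le1 : t <= 1 by rewrite ler_pdivrMr// mul1r lerDl.
have tE : t * (s + n) = s by rewrite divfK ?gt_eqF.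
have := moved t (ltW t_gt0) t_le1; apply/negP; rewrite -ltNge.
have -> : 2 * t * s = t * (2 * s) by ring.
rewrite expr2 -mulrA ltr_pM2l//.
have := mulr_gt0 t_gt0 s_gt0; lra.
Qed.

Lemma proj_nearest (R : realType) (d : nat) (D : set 'rV[R]_d)
    (x : 'rV[R]_d) :
  D !=set0 -> closed D -> nearest_points D x (proj D x).
Proof. by move=> D0 Dclosed; apply: xgetPex; exact: nearest_points_nonempty. Qed.

(** Substituting [c - p = (x - p) - (x - c)] turns the variational inequality into this form. *)
Lemma sqr_enorm_le_dot_proj (R : realType) (d : nat) (D : set 'rV[R]_d)
    (x c : 'rV[R]_d) :
  closed D -> convex_set D -> D c ->
  enorm (x - proj D x) ^+ 2 <= dot (x - c) (x - proj D x).
Proof.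
move=> Dclosed Dconvex Dc; set p := proj D x.
have Dxp : nearest_points D x p by apply: proj_nearest => //; exists c.
have := nearest_points_dot_le0 Dconvex Dxp Dc.
have -> : c - p = (x - p) - (x - c) by apply/rowP => i; rewrite !mxE; ring.
by rewrite dotC dotBl dot_self subr_le0.
Qed.

(* Where [k j = 0], the junk value [a j ^+ 2 / 0 = 0] is the right one
   because [a j = 0]. *)
Lemma sqr_sum_le_weighted (R : realFieldType) (N : nat) (k a : 'I_N -> R) :
  (forall j, 0 <= k j) -> \sum_(j < N) k j = 1 ->
  (forall j, k j = 0 -> a j = 0) ->
  (\sum_(j < N) a j) ^+ 2 <= \sum_(j < N) a j ^+ 2 / k j.
Proof.
move=> k_ge0 k_sum a0; set S := \sum_(j < N) a j.
rewrite -subr_ge0.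
(* As the weights sum to 1, the gap is the variance-like sum of [k j * (a j / k j - S) ^+ 2],
   expanded here to allow for [k j = 0]. *)
have -> : \sum_(j < N) a j ^+ 2 / k j - S ^+ 2 =
    \sum_(j < N) (a j ^+ 2 / k j - 2 * S * a j + k j * S ^+ 2).
  by rewrite big_split/= sumrB -mulr_sumr -mulr_suml k_sum -/S; ring.
apply: sumr_ge0 => j _.
have [kj0|kj_neq0] := eqVneq (k j) 0.
  by rewrite (a0 _ kj0) kj0 !(mulr0, mul0r, expr0n) subr0 addr0.
have -> : a j ^+ 2 / k j - 2 * S * a j + k j * S ^+ 2 =
    k j * (a j / k j - S) ^+ 2 by field.
by rewrite mulr_ge0 ?sqr_ge0.
Qed.

(** The scalar inequality is applied in each coordinate and summed. *)
Lemma sqr_enorm_sum_le_weighted (R : realType) (d N : nat)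
    (k a : 'I_N -> R) (u : 'I_N -> 'rV[R]_d) :
  (forall j, 0 <= k j) -> \sum_(j < N) k j = 1 ->
  (forall j, k j = 0 -> a j *: u j = 0) ->
  enorm (\sum_(j < N) a j *: u j) ^+ 2 <=
  \sum_(j < N) a j ^+ 2 / k j * enorm (u j) ^+ 2.
Proof.
move=> k_ge0 k_sum au0; rewrite sqr_enorm.
under [leRHS]eq_bigr do rewrite mulrAC -sqr_enormZ sqr_enorm mulr_suml.
rewrite exchange_big/=; apply: ler_sum => i _; rewrite summxE.
by apply: sqr_sum_le_weighted => // j /au0 ->; rewrite mxE.
Qed.

(** The real-valued case: by the last hypothesis, a junk quotient [beta j / 0] only ever multiplies
    a zero term. *)
Lemma sqr_enorm_Qop_le (R : realType) (d N : nat) (C : 'I_N -> set 'rV[R]_d)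
    (beta kappa : 'I_N -> R) (x c : 'rV[R]_d) :
  (forall j, closed (C j)) -> (forall j, convex_set (C j)) ->
  (forall j, 0 <= beta j) -> (forall j, 0 <= kappa j) ->
  \sum_(j < N) kappa j = 1 -> (forall j, C j c) ->
  (forall j, kappa j = 0 -> beta j *: (x - proj (C j) x) = 0) ->
  enorm (Qop C beta x - c) ^+ 2 <= enorm (x - c) ^+ 2 -
    \sum_(j < N) (2 - beta j / kappa j) * beta j *
                 enorm (x - proj (C j) x) ^+ 2.
Proof.
move=> C_closed C_convex beta_ge0 kappa_ge0 kappa_sum1 Cc degenerate.
rewrite /Qop addrAC (sqr_enormB (x - c)) dot_sumr.
have := sqr_enorm_sum_le_weighted kappa_ge0 kappa_sum1 degenerate.
have : \sum_(j < N) beta j * enorm (x - proj (C j) x) ^+ 2 <=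
    \sum_(j < N) dot (x - c) (beta j *: (x - proj (C j) x)).
  by apply: ler_sum => j _; rewrite dotZr ler_wpM2l// sqr_enorm_le_dot_proj.
(* After this split the claim is linear in the sums bounded above. *)
have -> : \sum_(j < N) (2 - beta j / kappa j) * beta j *
      enorm (x - proj (C j) x) ^+ 2 =
    2 * \sum_(j < N) beta j * enorm (x - proj (C j) x) ^+ 2 -
    \sum_(j < N) beta j ^+ 2 / kappa j * enorm (x - proj (C j) x) ^+ 2.
  by rewrite mulr_sumr -sumrB; apply: eq_bigr => j _; ring.
lra.
Qed.

Theorem proposition1 (R : realType) (d N : nat) (C : 'I_N -> set 'rV[R]_d)
  (C_nonempty : forall j, C j !=set0)
  (C_closed : forall j, closed (C j))
  (C_convex : forall j, convex_set (C j))
  (beta : 'I_N -> R) (beta_weights : weights beta)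
  (kappa : 'I_N -> R) (kappa_ge0 : forall j, 0 <= kappa j)
  (kappa_sum1 : \sum_(j < N) kappa j = 1)
  (x c : 'rV[R]_d) (Cc : (\bigcap_(j in setT) C j) c) :
  ((enorm (Qop C beta x - c) ^+ 2)%:E <=
    (enorm (x - c) ^+ 2)%:E -
    \sum_(j < N) (2%:E - (beta j)%:E / (kappa j)%:E) * (beta j)%:E *
                 (enorm (x - proj (C j) x) ^+ 2)%:E)%E.
Proof.
have [beta_ge0 _] := beta_weights.
have [[j [kj0 bu_neq0]]|nondeg] := pselect
  (exists j, kappa j = 0 /\ beta j *: (x - proj (C j) x) != 0).
  have -> : (\sum_(j < N) (2%:E - (beta j)%:E / (kappa j)%:E) * (beta j)%:E *
      (enorm (x - proj (C j) x) ^+ 2)%:E = -oo)%E.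
    (* One summand [-oo] decides the sum; no summand is [+oo], since [2 - beta j / kappa j] never
       exceeds 2. *)
    apply/esum_eqNyP; exists j; split=> //.
    move: bu_neq0; rewrite scaler_eq0 negb_or => /andP[b_neq0 u_neq0].
    have b_gt0 : 0 < beta j by rewrite lt_neqAle eq_sym b_neq0 beta_ge0.
    have e_gt0 : 0 < enorm (x - proj (C j) x) ^+ 2.
      (* A zero norm would make every coordinate vanish. *)
      rewrite lt_neqAle sqr_ge0 andbT eq_sym; apply: contra u_neq0 => /eqP e0.
      apply/eqP/rowP => i; apply/eqP; rewrite [X in _ == X]mxE -normr_le0.
      apply: le_trans (ler_coord_enorm _ _) _.
      by move/eqP: e0; rewrite sqrf_eq0 => /eqP ->.
    by rewrite kj0 edive0// !gt0_mulNye ?lte_fin.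
  by rewrite leey.
have degenerate j : kappa j = 0 -> beta j *: (x - proj (C j) x) = 0.
  by move=> kj0; apply/eqP/negP => /negP bu; apply: nondeg; exists j.
have -> : (\sum_(j < N) (2%:E - (beta j)%:E / (kappa j)%:E) * (beta j)%:E *
      (enorm (x - proj (C j) x) ^+ 2)%:E =
    (\sum_(j < N) (2 - beta j / kappa j) * beta j *
      enorm (x - proj (C j) x) ^+ 2)%:E)%E.
  rewrite -sumEFin; apply: eq_bigr => j _.
  have [kj0|kj_neq0] := eqVneq (kappa j) 0; last by rewrite ediv_fin.
  (* Both summands are 0 here: a zero factor absorbs even an infinite [2 - beta j / kappa j]. *)
  have /eqP := degenerate j kj0; rewrite scaler_eq0 => /orP[/eqP ->|/eqP ->].
    by rewrite !(mule0, mulr0, mul0e, mul0r).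
  by rewrite sqr_enorm big1 ?mule0 ?mulr0// => i _; rewrite mxE expr0n.
rewrite -EFinB lee_fin; apply: sqr_enorm_Qop_le => // j; exact: Cc.
Qed.
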